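(* Let $\lambda$ be an infinite cardinal and $n$ a positive integer. If $\mathscr{I}_\lambda^n$ is a subsemigroup of a topological semigroup $S$, then for every $k$ with $1\le k\le n$ the closure $\operatorname{cl}_S(\mathscr{I}_\lambda^k\setminus\mathscr{I}_\lambda^{k-1})$ in $S$ is not compact.
   Context: All topological spaces are assumed Hausdorff. A topological semigroup is a semigroup with a Hausdorff topology for which multiplication is (jointly) continuous. For a cardinal $\lambda$, $\mathscr{I}_\lambda$ denotes the symmetric inverse semigroup on the set $\lambda$: all one-to-one functions with domain and range subsets of $\lambda$ (including the empty transformation $0$), under composition $ab(x)=a(b(x))$ wherever defined. The rank of a transformation is the cardinality of its domain, and for each integer $k\ge 0$, $\mathscr{I}_\lambda^k$ is the ideal of $\mathscr{I}_\lambda$ consisting of the transformations of rank at most $k$. *)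

(* Defs.v *)
(* MathComp / MathComp-Analysis *)
From HB Require Import structures.
From mathcomp Require Import all_boot.
From mathcomp Require Import boolp classical_sets functions cardinality.
From mathcomp Require Import topology.

Set Implicit Arguments.
Unset Strict Implicit.
Unset Printing Implicit Defensive.

Local Open Scope classical_set_scope.

HB.mixin Record isTopologicalSemigroup S & Topological S & Semigroup S := {
  tsg_hausdorff : hausdorff_space S ;
  mulg_continuous : continuous (fun x : S * S => (x.1 * x.2)%g) ;
}.

#[short(type="topologicalSemigroupType")]
HB.structure Definition TopologicalSemigroup :=
  {S of Topological S & Semigroup S & isTopologicalSemigroup S}.

Section SymmetricInverseSemigroup.
Variable L : Type.

(* A partial transformation a of L is encoded as a map L -> option L:
   a x = None when a is not defined at x. *)
Record symInv := SymInv {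
  pmap_of :> L -> option L ;
  pmap_inj : forall x y z, pmap_of x = Some z -> pmap_of y = Some z -> x = y
}.

HB.instance Definition _ := gen_eqMixin symInv.
HB.instance Definition _ := gen_choiceMixin symInv.

Lemma symInv_eq (a b : symInv) : pmap_of a = pmap_of b -> a = b.
Proof.
case: a b => [f fI] [g gI] /= fg; move: gI; rewrite -fg => gI.
by congr SymInv; exact: Prop_irrelevance.
Qed.

Lemma comp_pmap_inj (a b : symInv) (x y z : L) :
  pcomp a b x = Some z -> pcomp a b y = Some z -> x = y.
Proof.
rewrite /pcomp; case bx: (b x) => [u|//]; case By: (b y) => [v|//] /= au av.
by apply: (pmap_inj bx); rewrite By (pmap_inj au av).
Qed.

(* (a b)(x) = a (b x), defined when b is defined at x and a at b x *)
Definition symInv_mul (a b : symInv) : symInv := SymInv (@comp_pmap_inj a b).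

Lemma symInv_mulA : associative symInv_mul.
Proof.
move=> a b c; apply: symInv_eq; apply: funext => x /=.
by rewrite /pcomp; case: (c x).
Qed.

HB.instance Definition _ := isSemigroup.Build symInv symInv_mulA.

Definition dom (a : symInv) : set L := [set x | a x].

(* The rank of a is the cardinality of dom a; rank_le k is the ideal of rank
   at most k, as a subset, and symInvIdeal n the same ideal as a semigroup. *)
Definition rank_le (k : nat) : set symInv := [set a | (dom a #<= `I_k)%card].

Variable n : nat.

Definition symInvIdeal : Type := {a : symInv | a \in rank_le n}.

HB.instance Definition _ := SubChoice.on symInvIdeal.

Lemma rank_le_mulg_closed : mulg_closed (mem (rank_le n)).
Proof.
move=> a b _ /set_mem bn; apply/mem_set.
apply: card_le_trans bn; apply: subset_card_le => x.
by rewrite /dom /= /pcomp; case: (b x).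
Qed.

HB.instance Definition _ :=
  SubChoice_isSubSemigroup.Build symInv (mem (rank_le n)) symInvIdeal
    rank_le_mulg_closed.

End SymmetricInverseSemigroup.

Arguments rank_le : clear implicits.
Arguments symInvIdeal : clear implicits.

(* Main.v *)
Require Import Defs.
From HB Require Import structures.
From mathcomp Require Import all_boot.
From mathcomp Require Import boolp classical_sets functions cardinality.
From mathcomp Require Import topology.

Local Open Scope classical_set_scope.

(** Split an infinite subset of [L] into disjoint blocks [h i] of size [k], and
let [e i j] be the bijection from block [j] onto block [i]. These are matrix
units of rank [k]: [e i j * e j l = e i l] and [e i j * e m l = 0] for
[j <> m]. If [K] contains all of them and is compact, the sequence
[(e 0 i, e i 0)] has a cluster point [(x, y)] in [K * K]; every neighbourhood of
[x * y] then contains both [e 0 i * e i 0 = e 0 0] and [e 0 i * e j 0 = 0]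
for some [i <> j], so that [e 0 0 = 0] by Hausdorff separation. *)

Lemma compact_orthogonal_sequences_eq {S : topologicalSemigroupType}
    {K : set S} {x y : nat -> S} {c d : S} :
  compact K -> (forall i, K (x i)) -> (forall i, K (y i)) ->
  (forall i, (x i * y i)%g = c) ->
  (forall i j, i <> j -> (x i * y j)%g = d) -> c = d.
Proof.
move=> cK Kx Ky xyc xyd.
have [|[p q] [_ pq]] :=
    compact_setX cK cK (F := (fun i => (x i, y i)) @ \oo) _ _.
  by exists 0%N => // i _; split => /=.
(* A cluster point of the sequence meets the image of every tail, so the index can be taken beyond
   any given [m]. *)
have often A B m : nbhs p A -> nbhs q B ->
    exists i, [/\ (m <= i)%N, A (x i) & B (y i)].
  move=> pA qB.
  have [||_ [[i mi <-] [Ai Bi]]] :=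
      pq ((fun i => (x i, y i)) @` [set i | (m <= i)%N]) (A `*` B).
  - by exists m => // i mi; exists i.
  - by exists (A, B).
  by exists i.
have lim_pq W : nbhs (p * q)%g W -> W c /\ W d.
  move=> /(mulg_continuous (p, q)) [[A B] /= [pA qB] ABW].
  have [i [_ Ai Bi]] := often A B 0 pA qB.
  (* Starting the tail at [i.+1] forces [j <> i]; since [A] and [B] are separate factors, the mixed
     pair [(x i, y j)] also lies in [A] times [B]. *)
  have [j [ij Aj Bj]] := often A B i.+1 pA qB.
  split; first by rewrite -(xyc i); exact: (ABW (x i, y i)).
  rewrite -(xyd i j); first exact: (ABW (x i, y j)).
  by move=> eij; rewrite eij ltnn in ij.
have limE z : (forall W, nbhs (p * q)%g W -> W z) -> (p * q)%g = z.
  move=> zW; apply: (@tsg_hausdorff S) => A B pqA zB.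
  by exists z; split; [exact: zW | exact: nbhs_singleton].
by transitivity (p * q)%g; [apply/esym|]; apply: limE => W pqW;
  have [] := lim_pq W pqW.
Qed.

Section PartialInjectionOfGraph.
Context {L : Type} {R : L -> L -> Prop}.
Hypothesis R_fun : forall x y z, R x y -> R x z -> y = z.
Hypothesis R_inj : forall x y z, R x z -> R y z -> x = y.

(** Being in the domain of a relation is not decidable in general, so excluded middle and choice
    produce the value. *)
Let graph_map (x : L) : option L :=
  if pselect (exists y, R x y) is left h then Some (sval (cid h)) else None.

Let graph_mapP {x y} : graph_map x = Some y <-> R x y.
Proof.
rewrite /graph_map; case: pselect => [h|nh]; last first.
  by split => // Rxy; case: nh; exists y.
case: cid => z /= Rxz; split => [[<-]//|Rxy].
by rewrite (R_fun _ _ _ Rxz Rxy).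
Qed.

Let graph_map_inj x y z :
  graph_map x = Some z -> graph_map y = Some z -> x = y.
Proof. by move=> /graph_mapP + /graph_mapP; exact: R_inj. Qed.

Definition graph_symInv : symInv L := @SymInv L graph_map graph_map_inj.

Lemma graph_symInvP x y : graph_symInv x = Some y <-> R x y.
Proof. exact: graph_mapP. Qed.

End PartialInjectionOfGraph.

Lemma symInv_mulP {L : Type} {a b : symInv L} {x z} :
  (a * b)%g x = Some z <-> exists2 y, b x = Some y & a y = Some z.
Proof.
rewrite /= /pcomp; case: (b x) => [u|] /=; split => //.
- by exists u.
- by case=> y [->].
- by case.
Qed.

Lemma symInv_ext {L : Type} (a b : symInv L) :
  (forall x y, a x = Some y <-> b x = Some y) -> a = b.
Proof.
move=> ab; apply: symInv_eq; apply: funext => x.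
case ax: (a x) => [y|]; first by apply/esym/ab.
by case bx: (b x) => [y|//]; move/ab: bx; rewrite ax.
Qed.

Section MatrixUnits.
Context {L : Type} (k : nat) {h : nat * nat -> L}.
Hypothesis h_inj : injective h.

(** Block [i] consists of the points [h (i, r)] with [r < k]; injectivity of [h] makes the blocks
    disjoint, with exactly [k] points each. *)
Let unit_graph i j x y :=
  exists2 r, (r < k)%N & x = h (j, r) /\ y = h (i, r).

Let unit_graph_fun i j x y z :
  unit_graph i j x y -> unit_graph i j x z -> y = z.
Proof. by case=> r _ [-> ->] [s _ [/h_inj[->] ->]]. Qed.

Let unit_graph_inj i j x y z :
  unit_graph i j x z -> unit_graph i j y z -> x = y.
Proof. by case=> r _ [-> ->] [s _ [-> /h_inj[->]]]. Qed.

Definition matrix_unit i j : symInv L :=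
  graph_symInv (unit_graph_fun i j) (unit_graph_inj i j).

Lemma matrix_unitP {i j x y} : matrix_unit i j x = Some y <->
  exists2 r, (r < k)%N & x = h (j, r) /\ y = h (i, r).
Proof. exact: graph_symInvP. Qed.

Lemma matrix_unit_mul i j l :
  (matrix_unit i j * matrix_unit j l)%g = matrix_unit i l.
Proof.
apply: symInv_ext => x z; rewrite symInv_mulP matrix_unitP; split.
  case=> y /matrix_unitP[r rk [-> ->]] /matrix_unitP[s _ [/h_inj[<-] ->]].
  by exists r.
by case=> r rk [-> ->]; exists (h (j, r)); apply/matrix_unitP; exists r.
Qed.

(** The right factor takes its values in block [m], which is disjoint from block [j], the domain of
    the left factor. *)
Lemma matrix_unit_mul0 i j m l x : j <> m ->
  (matrix_unit i j * matrix_unit m l)%g x = None.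
Proof.
move=> jm; case E: ((_ * _ : symInv L)%g x) => [z|//].
have /symInv_mulP[y] := E.
by move=> /matrix_unitP[r _ [_ ->]] /matrix_unitP[s _ [/h_inj[/esym/jm]]].
Qed.

Lemma card_dom_matrix_unit i j : (dom (matrix_unit i j) #= `I_k)%card.
Proof.
have -> : dom (matrix_unit i j) = (fun r => h (j, r)) @` `I_k.
  apply/seteqP; split => [x|_ [r rk <-]]; rewrite /dom /mkset.
    by case E: (matrix_unit i j x) => [y|//] _; have [r rk [->]] :=
      iffLR matrix_unitP E; exists r.
  by have -> : matrix_unit i j (h (j, r)) = Some (h (i, r));
    [apply/matrix_unitP; exists r|].
by apply: inj_card_eq => r s _ _ /h_inj[].
Qed.

(** The equivalence serves in both directions: [m = k] puts the units in the ideal of rank at most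
    [k], and [m = k.-1] keeps them out of the smaller one. *)
Lemma rank_le_matrix_unit {m i j} : rank_le L m (matrix_unit i j) <-> (k <= m)%N.
Proof.
by rewrite /rank_le /= (card_le_eql (card_dom_matrix_unit i j)) card_le_II.
Qed.

End MatrixUnits.

Theorem corollary23 (L : Type) (hL : infinite_set [set: L])
    (n : nat) (hn : (0 < n)%N)
    (S : topologicalSemigroupType)
    (f : {multiplicative symInvIdeal L n -> S}) (hf : injective f)
    (k : nat) (hk : (1 <= k <= n)%N) :
  ~ compact (closure
      (f @` [set a | (rank_le L k `\` rank_le L k.-1) (val a)])).
Proof.
move=> cK; have /andP[k0 kn] := hk.
have [g g_inj] : exists g : nat -> L, injective g.
  have [x0 _] := infinite_setN0 hL.
  pose pL : pointedType :=
    HB.pack L (gen_eqMixin L) (gen_choiceMixin L) (isPointed.Build L x0).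
  have /infiniteP/(@pcard_injP _ pL)[g g_inj] := hL.
  by exists g => x y; apply: g_inj; rewrite inE.
have h_inj : injective (g \o @pickle (nat * nat)%type).
  by apply: inj_comp => //; exact: (pcan_inj pickleK).
pose u i j := matrix_unit k h_inj i j.
have u_n i j : u i j \in rank_le L n.
  by apply/mem_set/rank_le_matrix_unit.
pose e i j : symInvIdeal L n := Sub (u i j) (u_n i j).
have Ke i j : closure
    (f @` [set a | (rank_le L k `\` rank_le L k.-1) (val a)]) (f (e i j)).
  apply: subset_closure; exists (e i j) => //; split.
    exact/rank_le_matrix_unit.
  by move/rank_le_matrix_unit; rewrite leqNgt prednK // leqnn.
have e_mul i j l : (e i j * e j l)%g = e i l.
  by apply: val_inj; rewrite gmulfM; exact: matrix_unit_mul.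
have e_mul0 i j m l x : j <> m -> val (e i j * e m l)%g x = None.
  by move=> jm; rewrite gmulfM; exact: matrix_unit_mul0.
(* The product [e 0 0 * e 1 0] of mismatched units stands for the empty transformation. *)
have : f (e 0 0)%N = f (e 0%N 0%N * e 1%N 0%N)%g.
  apply: (compact_orthogonal_sequences_eq cK (Ke 0%N) (Ke^~ 0%N)).
    by move=> i; rewrite -gmulfM e_mul.
  move=> i j ij; rewrite -gmulfM; congr (f _); apply: val_inj.
  by apply: symInv_eq; apply: funext => x; rewrite !e_mul0.
move/hf/(congr1 val) => e00.
(* As [0 < k], block [0] has a point with [r = 0], which [u 0 0] fixes, so this unit is not
   empty. *)
have : u 0%N 0%N (g (pickle (0, 0)%N)) = Some (g (pickle (0, 0)%N)).
  by apply/matrix_unitP; exists 0%N.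
by rewrite -[u 0%N 0%N]/(val (e 0 0)%N) e00 e_mul0.
Qed.
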